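(* Let $\mathcal P$ satisfy the standing assumptions (P1)–(P3) of the context. Then there exists a universal constant $C$ such that, for all $Y\in\mathbb D(\mathbb F)$, $$\|Y\|_{\mathcal P}\le C\,\|Y\|_G .$$
   Context: Fix $T>0$. Let $(\Omega,\mathcal F,\mathbb F)$ be a filtered space with $\mathbb F=(\mathcal F_t)_{0\le t\le T}$ right continuous, and $\mathcal P$ a family of probability measures on it. For $\mathbb P\in\mathcal P$ and an $\mathbb F$-stopping time $\tau$, let $\mathcal P(\tau,\mathbb P):=\{\mathbb P'\in\mathcal P:\mathbb P'=\mathbb P\text{ on }\mathcal F_\tau\}$. Standing assumptions: (P1) for every $\mathbb P\in\mathcal P$, the $\mathbb P$-augmentation of $\mathbb F$ is a Brownian filtration (consequently every $\mathbb F$-martingale under $\mathbb P$ is continuous, $\mathbb P$-a.s.); (P2) $\mathcal N_{\mathcal P}\subset\mathcal F_0$, where $\mathcal N_{\mathcal P}$ is the set of all $E\in\mathcal F$ with $\mathbb P(E)=0$ for all $\mathbb P\in\mathcal P$; (P3) for any $\mathbb P\in\mathcal P$, $\mathbb F$-stopping time $\tau$, $\mathbb P_1,\mathbb P_2\in\mathcal P(\tau,\mathbb P)$, and any partition $E_1,E_2\in\mathcal F_\tau$ of $\Omega$, the measure $\bar{\mathbb P}(E):=\mathbb P_1(E\cap E_1)+\mathbb P_2(E\cap E_2)$, $E\in\mathcal F$, belongs to $\mathcal P(\tau,\mathbb P)$. $\mathbb D(\mathbb F)$ is the space of $\mathbb F$-progressively measurable càdlàg processes on $[0,T]$, and $\mathbb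 E^{\mathbb P}_\tau[\cdot]=\mathbb E^{\mathbb P}[\cdot|\mathcal F_\tau]$. For $\mathcal F$-measurable $\xi$ with $\mathbb E^{\mathbb P}[|\xi|]<\infty$ for all $\mathbb P\in\mathcal P$, set $\mathbb E^G[\xi]:=\sup_{\mathbb P\in\mathcal P}\mathbb E^{\mathbb P}[\xi]$ and $$\mathbb E^{G,\mathbb P}_\tau[\xi]:=\operatorname*{ess\,sup}^{\mathbb P}_{\mathbb P'\in\mathcal P(\tau,\mathbb P)}\mathbb E^{\mathbb P'}_\tau[\xi],\quad\mathbb P\text{-a.s.},$$ taken $\mathcal F_\tau$-measurable. For $Y\in\mathbb D(\mathbb F)$, $$\|Y\|_{\mathbb P}^2:=\mathbb E^{\mathbb P}\Big[\sup_{0\le t\le T}|Y_t|^2\Big]+\sup_\pi\mathbb E^{\mathbb P}\Big[\Big(\sum_{i=0}^{n-1}\big|\mathbb E^{\mathbb P}_{\tau_i}(Y_{\tau_{i+1}})-Y_{\tau_i}\big|\Big)^2\Big],\qquad \|Y\|_{\mathcal P}:=\sup_{\mathbb P\in\mathcal P}\|Y\|_{\mathbb P},$$ $$\|Y\|_G^2:=\mathbb E^G\Big[\sup_{0\le t\le T}|Y_t|^2\Big]+\sup_\pi\sup_{\mathbb P\in\mathcal P}\mathbb E^{\mathbb P}\Big[\Big(\sum_{i=0}^{n-1}\big|\mathbb E^{G,\mathbb P}_{\tau_i}(Y_{\tau_{i+1}})-Y_{\tau_i}\big|\Big)^2\Big],$$ with suprema over partitions $\pi:0=\tau_0\le\cdots\le\tau_n=T$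 by $\mathbb F$-stopping times; each quantity is $\infty$ if its first term is infinite. *)

(* Defs.v *)
From HB Require Import structures.
From mathcomp Require Import all_boot all_order all_algebra.
From mathcomp Require Import all_classical all_reals all_analysis.
From mathcomp Require Import measurable_realfun.

Set Implicit Arguments.
Unset Strict Implicit.
Unset Printing Implicit Defensive.

Import Order.TTheory GRing.Theory Num.Theory.
Import numFieldNormedType.Exports.

Local Open Scope classical_set_scope.
Local Open Scope ring_scope.

Section filtrations.
Context {d : measure_display} {Omega : measurableType d} {R : realType}.
Variable T : R.
Implicit Types (F : R -> set (set Omega)) (tau : Omega -> R).

(* Only the values [F t] for [0 <= t <= T] are relevant. *)
Record is_filtration F : Prop := {
  filtration_sigma : forall t : R, 0 <= t <= T -> sigma_algebra setT (F t) ;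
  filtration_sub : forall t : R, 0 <= t <= T -> F t `<=` measurable ;
  filtration_homo : forall s t : R, 0 <= s -> s <= t -> t <= T -> F s `<=` F t }.

Definition right_continuous_filtration F : Prop :=
  forall t : R, 0 <= t < T -> F t = \bigcap_(s in [set s | t < s <= T]) F s.

Definition stopping_time F tau : Prop :=
  (forall w, 0 <= tau w <= T) /\
  (forall t : R, 0 <= t <= T -> F t [set w | tau w <= t]).

(* For [t = T] the condition says in particular that [E] is in [F T]. *)
Definition stopped_sigma F tau : set (set Omega) :=
  [set E | forall t : R, 0 <= t <= T -> F t (E `&` [set w | tau w <= t])].

Definition progressively_measurable F (Y : R -> Omega -> R) : Prop :=
  forall t : R, 0 <= t <= T ->
    measurable_fun
      (`[0, t] `*` setT : set (measurableTypeR R * g_sigma_algebraType (F t)))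
      (fun x : measurableTypeR R * g_sigma_algebraType (F t) => Y x.1 x.2).

Definition cadlag (Y : R -> Omega -> R) : Prop :=
  forall w,
    (forall t : R, 0 <= t < T -> Y s w @[s --> t^'+] --> Y t w) /\
    (forall t : R, 0 < t <= T -> cvg (Y s w @[s --> t^'-])).

Definition Dspace F (Y : R -> Omega -> R) : Prop :=
  progressively_measurable F Y /\ cadlag Y.

Definition stopping_partition F (n : nat) (tau : nat -> Omega -> R) : Prop :=
  [/\ forall i, (i <= n)%N -> stopping_time F (tau i),
      forall w, tau 0%N w = 0,
      forall w, tau n w = T &
      forall i w, (i < n)%N -> tau i w <= tau i.+1 w].

Definition augmentation (P : probability Omega R) (G : set (set Omega)) :
    set (set Omega) :=
  <<s G `|` [set N | P.-negligible N] >>.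

Definition natural_filtration (n : nat) (W : 'I_n -> R -> Omega -> R) (t : R) :
    set (set Omega) :=
  <<s [set E | exists i u B,
         [/\ 0 <= u <= t, measurable (B : set R) & E = W i u @^-1` B] ]>>.

Record is_brownian_motion (P : probability Omega R) (n : nat)
    (W : 'I_n -> R -> Omega -> R) : Prop := {
  bm_measurable : forall i (t : R), 0 <= t <= T ->
    measurable_fun setT (W i t) ;
  bm_start : forall i w, W i 0 w = 0 ;
  bm_continuous : forall i w, {within `[0, T], continuous (fun t => W i t w)} ;
  (* [normal_prob m s] has standard deviation [s] *)
  bm_gaussian : forall i (s t : R) (B : set R),
    0 <= s -> s < t -> t <= T -> measurable B ->
    P [set w | B (W i t w - W i s w)] = normal_prob 0 (Num.sqrt (t - s)) B ;
  (* the n components of the increment over [s, t] and the past up to time s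
     are mutually independent *)
  bm_independent : forall (s t : R) (A : set Omega) (B : 'I_n -> set R),
    0 <= s -> s < t -> t <= T -> natural_filtration W s A ->
    (forall i, measurable (B i)) ->
    P (A `&` \bigcap_i [set w | B i (W i t w - W i s w)]) =
    (P A * \prod_(i < n) P [set w | B i (W i t w - W i s w)%R])%E }.

Definition augmentation_is_brownian F (P : probability Omega R) : Prop :=
  exists n (W : 'I_n -> R -> Omega -> R),
    [/\ (0 < n)%N, is_brownian_motion P W &
        forall t : R, 0 <= t <= T ->
          augmentation P (F t) = augmentation P (natural_filtration W t)].

(* [probability] records also assign (irrelevant) values to non-measurable
   sets, so membership in [calP] is only ever combined with equalities on
   measurable sets. *)
Definition agreeing F (calP : set (probability Omega R)) tau
    (P : probability Omega R) : set (probability Omega R) :=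
  [set P' | calP P' /\ forall E, stopped_sigma F tau E -> P' E = P E].

Record standing_assumptions F (calP : set (probability Omega R)) : Prop := {
  brownian_filtrations : forall P, calP P -> augmentation_is_brownian F P ;
  polar_sets : forall E, measurable E -> (forall P, calP P -> P E = 0%E) ->
    F 0 E ;
  pasting : forall P tau P1 P2 E1 E2,
    calP P -> stopping_time F tau ->
    agreeing F calP tau P P1 -> agreeing F calP tau P P2 ->
    stopped_sigma F tau E1 -> stopped_sigma F tau E2 ->
    E1 `&` E2 = set0 -> E1 `|` E2 = setT ->
    exists2 Q, agreeing F calP tau P Q &
      forall E, measurable E -> Q E = (P1 (E `&` E1) + P2 (E `&` E2))%E }.

End filtrations.

Section conditional_expectations.
Context {d : measure_display} {Omega : measurableType d} {R : realType}.
Implicit Types (P : probability Omega R) (G : set (set Omega)).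
Local Open Scope ereal_scope.

Definition is_cond_expectation P G (X Z : Omega -> R) : Prop :=
  [/\ measurable_fun setT (Z : g_sigma_algebraType G -> R),
      P.-integrable setT (EFin \o Z) &
      forall A, G A -> \int[P]_(w in A) (Z w)%:E = \int[P]_(w in A) (X w)%:E].

(* A chosen version; meaningful when [G] is a sub-sigma-algebra and [X] is
   [P]-integrable. *)
Definition cond_expectation P G (X : Omega -> R) : Omega -> R :=
  xget (cst 0%R) [set Z | is_cond_expectation P G X Z].

Definition is_ess_sup_family P G (A : set (Omega -> \bar R))
    (Z : Omega -> \bar R) : Prop :=
  [/\ measurable_fun setT (Z : g_sigma_algebraType G -> \bar R),
      forall f, A f -> {ae P, forall w, f w <= Z w} &
      forall Z' : Omega -> \bar R, measurable_fun setT Z' ->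
        (forall f, A f -> {ae P, forall w, f w <= Z' w}) ->
        {ae P, forall w, Z w <= Z' w}].

Definition ess_sup_family P G (A : set (Omega -> \bar R)) : Omega -> \bar R :=
  xget (cst 0) [set Z | is_ess_sup_family P G A Z].

Definition cond_G_expectation (T : R) (F : R -> set (set Omega))
    (calP : set (probability Omega R)) P (tau : Omega -> R) (X : Omega -> R) :
    Omega -> \bar R :=
  ess_sup_family P (stopped_sigma T F tau)
    [set EFin \o cond_expectation P' (stopped_sigma T F tau) X
       | P' in agreeing T F calP tau P].

Definition G_expectation (calP : set (probability Omega R))
    (X : Omega -> \bar R) : \bar R :=
  ereal_sup [set \int[P]_w X w | P in calP].

End conditional_expectations.

Section norms.
Context {d : measure_display} {Omega : measurableType d} {R : realType}.
Variables (T : R) (F : R -> set (set Omega)).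
Implicit Types (P : probability Omega R) (calP : set (probability Omega R))
  (Y : R -> Omega -> R).
Local Open Scope ereal_scope.

Definition sup_sq Y (w : Omega) : \bar R :=
  ereal_sup [set ((`|Y t w| ^+ 2)%R)%:E | t in `[0%R, T]].

Definition at_time Y (tau : Omega -> R) (w : Omega) : R := Y (tau w) w.

Definition variation_P P Y (n : nat) (tau : nat -> Omega -> R) (w : Omega) :
    \bar R :=
  \sum_(i < n)
    `| (cond_expectation P (stopped_sigma T F (tau i))
          (at_time Y (tau i.+1)) w)%:E - (at_time Y (tau i) w)%:E |.

Definition variation_G calP P Y (n : nat) (tau : nat -> Omega -> R)
    (w : Omega) : \bar R :=
  \sum_(i < n)
    `| cond_G_expectation T F calP P (tau i) (at_time Y (tau i.+1)) w
       - (at_time Y (tau i) w)%:E |.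

(* The convention that a norm is infinite as soon as its first term is comes
   for free: the second term is a supremum of integrals of squares, hence is
   nonnegative and does not affect an infinite first term.  When the first
   term is finite, all conditional expectations below are those of integrable
   random variables. *)
Definition norm_P P Y : \bar R :=
  sqrte (\int[P]_w sup_sq Y w +
    ereal_sup [set x | exists n tau, stopping_partition T F n tau /\
      x = \int[P]_w (variation_P P Y n tau w) ^+ 2]).

Definition norm_calP calP Y : \bar R :=
  ereal_sup [set norm_P P Y | P in calP].

Definition norm_G calP Y : \bar R :=
  sqrte (G_expectation calP (sup_sq Y) +
    ereal_sup [set x | exists n tau, stopping_partition T F n tau /\
      x = ereal_sup [set \int[P]_w (variation_G calP P Y n tau w) ^+ 2
                       | P in calP]]).

End norms.

(* Main.v *)
(** Fix [P] in [calP] and a partition, and put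
    [p_i = E^P_{tau_i}(Y_{tau_{i+1}}) - Y_{tau_i}].  Since [P] is itself a
    competitor in the essential supremum, [p_i] is at most the corresponding
    [G]-increment, so [Q := sum_i p_i^+] is dominated by the [G]-variation.
    For the negative parts let [N := sum_i p_i^-] and
    [S := max_i |Y_{tau_i}|].  Then
    [N^2 <= 2 sum_{i <= j} p_i^- p_j^-], and replacing
    [p_j^- = p_j^+ - p_j] by [p_j^+ - (Y_{tau_{j+1}} - Y_{tau_j})] changes
    the expectation by nothing, because [p_i^-] is [F_{tau_j}]-measurable.
    The new sum telescopes and is at most [N (Q + 2 S)], which bounds
    [E N^2] by a combination of [E Q^2] and [E S^2]. *)
Require Import Defs.
From HB Require Import structures.
From mathcomp Require Import all_boot all_order all_algebra.
From mathcomp Require Import all_classical all_reals all_analysis.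
From mathcomp Require Import measurable_realfun.
From mathcomp Require Import ring lra.

Set Implicit Arguments.
Unset Strict Implicit.
Unset Printing Implicit Defensive.

Import Order.TTheory GRing.Theory Num.Theory.
Import numFieldNormedType.Exports.
Import HBNNSimple.
Local Open Scope classical_set_scope.
Local Open Scope ring_scope.

(** * Conditional expectation given a sub-sigma-algebra *)

Section sub_sigma_algebra.
Context {d : measure_display} {Omega : measurableType d} {R : realType}.
Variables (P : probability Omega R) (G : set (set Omega)).
Hypotheses (sG : sigma_algebra setT G) (Gm : G `<=` measurable).
Local Open Scope ereal_scope.
Implicit Types X Z V H : Omega -> R.

Lemma measurable_g_sigmaE (A : set Omega) :
  measurable (A : set (g_sigma_algebraType G)) = G A.
Proof.
have -> : measurable (A : set (g_sigma_algebraType G)) = <<s G >> A by [].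
by rewrite sigma_algebra_id.
Qed.

Let measurable_g_sigma_id :
  measurable_fun setT (id : Omega -> g_sigma_algebraType G).
Proof.
by move=> _ A; rewrite measurable_g_sigmaE setTI => /Gm.
Qed.

Lemma measurable_fun_g_sigma d' (U : measurableType d') (f : Omega -> U) :
  measurable_fun setT (f : g_sigma_algebraType G -> U) -> measurable_fun setT f.
Proof. by move=> mf; exact: measurableT_comp mf measurable_g_sigma_id. Qed.

(** Radon-Nikodym: pushing [P] and the charge [A |-> \int_A X dP] forward along the identity, onto
    the measurable space generated by [G], restricts both to [G]; the density of the second with
    respect to the first is a version. *)
Lemma cond_expectationP X : P.-integrable setT (EFin \o X) ->
  is_cond_expectation P G X (cond_expectation P G X).
Proof.
move=> iX; rewrite /cond_expectation; case: xgetP => [Z -> //|noZ]; exfalso.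
pose idG : {mfun Omega >-> g_sigma_algebraType G} :=
  HB.pack (id : Omega -> g_sigma_algebraType G)
    (isMeasurableFun.Build _ _ _ _ _ measurable_g_sigma_id).
pose mu := distribution P idG.
(* [pose] abstracts over the measurability proof of [idG] *)
pose charge_of : {charge set (g_sigma_algebraType G) -> \bar R} :=
  pushforward (induced_charge iX) idG.
pose nu := charge_of measurable_g_sigma_id.
have nuE A : G A -> nu A = \int[P]_(w in A) (X w)%:E by [].
have numu : nu `<< mu.
  apply/null_content_dominatesP => A; rewrite measurable_g_sigmaE => GA PA0.
  rewrite nuE// null_set_integral//; first exact: Gm.
  exact/measurable_funTS/measurable_int/iX.
pose f := Radon_Nikodym nu mu.
have ffin w : f w \is a fin_num by exact: Radon_Nikodym_fin_num.
have fi : mu.-integrable setT f by exact: Radon_Nikodym_integrable.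
have mf : measurable_fun setT f by exact: measurable_int fi.
have fP : P.-integrable setT f.
  apply/integrableP; split; first exact: measurable_fun_g_sigma.
  move/integrableP : fi => [_]; rewrite ge0_integral_pushforward//.
  exact: measurableT_comp.
apply: (noZ (fine \o f)); split.
- exact: measurableT_comp.
- by apply: eq_integrable fP => // w _ /=; rewrite fineK.
- move=> A GA; rewrite -nuE// (@Radon_Nikodym_integral _ _ _ nu mu A)//.
  + rewrite integral_pushforward//.
    * by apply: eq_integral => w _ /=; rewrite fineK.
    * by apply: integrableS fP => //; exact: Gm.
    * by rewrite measurable_g_sigmaE.
  + by rewrite measurable_g_sigmaE.
Qed.

(** Since [V] has integral zero over each set of [G], linearity covers simple weights. For a
    nonnegative weight [K], the products of its simple approximations with [V] are dominated by
    [|K V|]; a general [H], possibly unbounded, is split into positive and negative parts. *)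
Lemma integral_mul_eq0 V H :
  P.-integrable setT (EFin \o V) ->
  (forall A, G A -> \int[P]_(w in A) (V w)%:E = 0) ->
  measurable_fun setT (H : g_sigma_algebraType G -> R) ->
  P.-integrable setT (fun w => (H w * V w)%:E) ->
  \int[P]_w (H w * V w)%:E = 0.
Proof.
move=> iV V0.
have pos K : (forall w, 0 <= K w)%R ->
    measurable_fun setT (K : g_sigma_algebraType G -> R) ->
    P.-integrable setT (fun w => (K w * V w)%:E) ->
    \int[P]_w (K w * V w)%:E = 0.
  move=> K0 mK iKV.
  have mEK : measurable_fun setT (EFin \o K : g_sigma_algebraType G -> \bar R).
    exact/measurable_EFinP.
  pose h := nnsfun_approx measurableT mEK.
  have mh n : measurable_fun setT (h n : Omega -> R).
    by apply: measurable_fun_g_sigma; exact: measurable_funP.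
  have hK w : (h n w)%:E @[n --> \oo] --> (K w)%:E.
    by apply: (@cvg_nnsfun_approx _ _ _ _ _ _ mEK) => // x _; rewrite lee_fin.
  have mV := measurable_int _ iV.
  have [_ _] : [/\ P.-integrable setT (fun w => (K w * V w)%:E),
      [sequence \int[P]_w `|(h n w * V w)%:E - (K w * V w)%:E|]_n @ \oo --> 0 &
      [sequence \int[P]_w (h n w * V w)%:E]_n @ \oo
        --> \int[P]_w (K w * V w)%:E].
    apply: (@dominated_convergence _ _ _ P setT measurableT _ _
      (fun w => `|(K w * V w)%:E|)) => //.
    - move=> n; apply/measurable_EFinP; apply: measurable_funM => //.
      exact/measurable_EFinP.
    - exact: measurable_int iKV.
    - apply: aeW => w _; under eq_fun do rewrite EFinM.
      by rewrite EFinM; apply: cvgeZr => //; exact: hK.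
    - exact: integrable_abse iKV.
    - apply: aeW => w n _; rewrite !abse_EFin lee_fin !normrM.
      apply: ler_wpM2r => //; rewrite !ger0_norm//.
      rewrite -lee_fin nnsfun_approxE.
      by apply: (@le_approx _ _ _ _ (EFin \o K)) => // x _; rewrite lee_fin.
  suff hV0 n : \int[P]_w (h n w * V w)%:E = 0.
    move=> /cvg_lim <- //; rewrite (_ : [sequence _]_n = cst 0) ?lim_cst//.
    by apply/funext => n /=; rewrite hV0.
  (* [h n] has finite range, so the integral is a finite combination of integrals of [V] over level
     sets, all of which lie in [G]. *)
  pose r := finmap.enum_fset (fset_set (range (h n))).
  pose A y : set Omega := h n @^-1` [set y].
  have GA y : G (A y) by rewrite -measurable_g_sigmaE; exact: measurable_sfunP.
  have AV y : (fun w : Omega => (\1_(A y) w * V w)%:E) =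
      (fun w : Omega => (V w)%:E) \_ (A y).
    by rewrite epatch_indic; apply/funext => w; rewrite EFinM muleC.
  have iAV y : P.-integrable setT (fun w => (\1_(A y) w * V w)%:E).
    rewrite AV.
    have mA := Gm (GA y).
    by apply/(integrable_mkcond _ mA); exact: integrableS iV.
  transitivity (\int[P]_w \sum_(y <- r) (y%:E * (\1_(A y) w * V w)%:E)).
    apply: eq_integral => w _; rewrite (fimfunE (h n)) fsbig_finite//=.
    rewrite mulr_suml -sumEFin; apply: eq_bigr => y _.
    by rewrite -EFinM mulrA.
  rewrite integral_sum//; last by move=> y; exact: integrableZl.
  rewrite big1// => y _; rewrite integralZl//.
  by rewrite AV -integral_mkcond V0// mule0.
move=> mH iHV.
have [mHp mHn] : measurable_fun setT ((H^\+)%R : g_sigma_algebraType G -> R) /\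
    measurable_fun setT ((H^\-)%R : g_sigma_algebraType G -> R).
  by split; [exact: measurable_funrpos|exact: measurable_funrneg].
have mV : measurable_fun setT V by apply/measurable_EFinP; exact: measurable_int iV.
have iV' K : measurable_fun setT (K : g_sigma_algebraType G -> R) ->
  (forall w, `|K w| <= `|H w|)%R -> P.-integrable setT (fun w => (K w * V w)%:E).
  move=> mK KH; apply: le_integrable iHV => //.
    by apply/measurable_EFinP/measurable_funM => //; exact: measurable_fun_g_sigma.
  by move=> w _; rewrite !abse_EFin lee_fin !normrM ler_wpM2r.
have Hpn w : (H w * V w)%:E = ((H^\+)%R w * V w)%:E - ((H^\-)%R w * V w)%:E.
  by rewrite -EFinB -mulrBl -[in LHS](funrposBneg H).
have normH w : (`|H w| = H^\+ w + H^\- w)%R.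
  by rewrite -[LHS]/((Num.norm \o H) w) -funrposDneg.
have iHp : P.-integrable setT (fun w => ((H^\+)%R w * V w)%:E).
  apply: iV' => // w; rewrite normH ger0_norm ?funrpos_ge0//.
  by rewrite lerDl funrneg_ge0.
have iHn : P.-integrable setT (fun w => ((H^\-)%R w * V w)%:E).
  apply: iV' => // w; rewrite normH ger0_norm ?funrneg_ge0//.
  by rewrite lerDr funrpos_ge0.
under eq_integral do rewrite Hpn.
by rewrite integralB// !pos ?sube0.
Qed.
End sub_sigma_algebra.

(** * Square-integrable random variables *)

Section square_integrable.
Context {d : measure_display} {Omega : measurableType d} {R : realType}.
Variable P : probability Omega R.
Local Open Scope ereal_scope.
Implicit Types f g : Omega -> R.

Definition square_integrable f :=
  measurable_fun setT f /\ P.-integrable setT (fun w => (f w ^+ 2)%:E).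

Lemma square_integrable_lty f : measurable_fun setT f ->
  \int[P]_w (f w ^+ 2)%:E < +oo -> square_integrable f.
Proof.
move=> mf foo; split => //; apply/integrableP; split.
  exact/measurable_EFinP/measurable_funX.
by under eq_integral do rewrite gee0_abs ?lee_fin ?sqr_ge0//.
Qed.

Lemma square_integrableM f g : square_integrable f -> square_integrable g ->
  P.-integrable setT (fun w => (f w * g w)%:E).
Proof.
move=> [mf sf] [mg sg]; apply: (le_integrable _ _ _ (integrableD _ sf sg)) => //.
  exact/measurable_EFinP/measurable_funM.
move=> w _; rewrite -EFinD !abse_EFin lee_fin normrM.
rewrite [leRHS]ger0_norm ?addr_ge0 ?sqr_ge0//.
rewrite -(real_normK (num_real (f w))) -(real_normK (num_real (g w))).
have := sqr_ge0 (`|f w| - `|g w|); have := normr_ge0 (f w).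
have := normr_ge0 (g w).
by nra.
Qed.

Lemma square_integrable_le f g : measurable_fun setT f ->
  (forall w, `|f w| <= `|g w|)%R -> square_integrable g -> square_integrable f.
Proof.
move=> mf fg [mg sg]; split => //; apply: le_integrable sg => //.
  exact/measurable_EFinP/measurable_funX.
by move=> w _; rewrite !abse_EFin lee_fin !normrX lerXn2r ?nnegrE.
Qed.

Lemma square_integrableD f g : square_integrable f -> square_integrable g ->
  square_integrable (fun w => f w + g w)%R.
Proof.
move=> sf sg; split; first exact: measurable_funD sf.1 sg.1.
have i2 := integrableZl measurableT 2 (square_integrableM sf sg).
have := integrableD measurableT (integrableD measurableT sf.2 sg.2) i2.
apply: eq_integrable => // w _ /=.
by rewrite -EFinM -!EFinD; congr EFin; ring.
Qed.

Lemma square_integrableN f : square_integrable f ->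
  square_integrable (fun w => - f w)%R.
Proof.
move=> sf; apply: (square_integrable_le _ _ sf); first exact: measurable_funN sf.1.
by move=> w; rewrite normrN.
Qed.

Lemma square_integrable_sum n (f : 'I_n -> Omega -> R) :
  (forall i, square_integrable (f i)) ->
  square_integrable (fun w => \sum_(i < n) f i w)%R.
Proof.
elim: n f => [|n IH] f sf.
  under eq_fun do rewrite big_ord0.
  by split => //; under eq_fun do rewrite expr0n; exact: integrable0.
under eq_fun do rewrite big_ord_recr.
by apply: square_integrableD => //; exact: IH.
Qed.

Lemma square_integrable1 f : square_integrable f ->
  P.-integrable setT (EFin \o f).
Proof.
move=> sf; have : square_integrable (cst 1%R).
  split => //; under eq_fun do rewrite expr1n.
  exact: finite_measure_integrable_cst.
move=> /(square_integrableM sf); apply: eq_integrable => // w _ /=.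
by rewrite mulr1.
Qed.

End square_integrable.

(** * Conditional expectation of square-integrable variables *)

Section cond_expectation_square.
Context {d : measure_display} {Omega : measurableType d} {R : realType}.
Variables (P : probability Omega R) (G : set (set Omega)).
Hypotheses (sG : sigma_algebra setT G) (Gm : G `<=` measurable).
Local Open Scope ereal_scope.
Implicit Types X Z V H : Omega -> R.

Lemma integral_cond_expectation_orth X H :
  P.-integrable setT (EFin \o X) ->
  measurable_fun setT (H : g_sigma_algebraType G -> R) ->
  let V := (fun w => X w - cond_expectation P G X w)%R in
  P.-integrable setT (fun w => (H w * V w)%:E) ->
  \int[P]_w (H w * V w)%:E = 0.
Proof.
move=> iX mH V iHV; have [mZ iZ ZX] := cond_expectationP sG Gm iX.
apply: (integral_mul_eq0 sG Gm) => //.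
  rewrite (_ : EFin \o V = (EFin \o X) \- (EFin \o cond_expectation P G X))//.
  exact: integrableB.
move=> A GA; have mA := Gm GA; under eq_integral do rewrite EFinB.
rewrite integralB//; [|exact: integrableS iX|exact: integrableS iZ].
rewrite ZX// subee// integrable_fin_num//; exact: integrableS iX.
Qed.

(** Contraction in L^2 by truncation: a bounded [G]-measurable truncation [Zn] of [Z] is orthogonal
    to [X - Z], which gives [E Zn^2 <= E X^2]; monotone convergence then passes to [Z]. *)
Lemma square_integrable_cond_expectation X : square_integrable P X ->
  square_integrable P (cond_expectation P G X).
Proof.
move=> sX; have iX := square_integrable1 sX.
have [mZ iZ ZX] := cond_expectationP sG Gm iX.
set Z := cond_expectation P G X in mZ iZ ZX *.
have mZ' : measurable_fun setT Z by exact: measurable_fun_g_sigma mZ.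
(* Cutting to zero, rather than clipping at [n], gives [Zn Z = Zn^2] exactly. *)
pose Zn (n : nat) w : R := if (`|Z w| <= n%:R)%R then Z w else 0%R.
have mZn n : measurable_fun setT (Zn n : g_sigma_algebraType G -> R).
  by apply: measurable_fun_ifT => //; apply: measurable_fun_ler => //;
    exact: measurableT_comp.
have mZn' n : measurable_fun setT (Zn n) by exact: measurable_fun_g_sigma (mZn n).
have Znn n w : (`|Zn n w| <= n%:R)%R.
  by rewrite /Zn; case: ifPn => //; rewrite normr0.
have ZnZ n w : (Zn n w * Z w = Zn n w ^+ 2)%R.
  by rewrite /Zn; case: ifPn => // _; rewrite mul0r expr0n.
pose V w := (X w - Z w)%R.
have iV : P.-integrable setT (EFin \o V).
  rewrite (_ : EFin \o V = (EFin \o X) \- (EFin \o Z))//.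
  exact: integrableB.
have iZnV n : P.-integrable setT (fun w => (Zn n w * V w)%:E).
  apply: (le_integrable _ _ _ (integrableZl measurableT n%:R iV)) => //.
    apply/measurable_EFinP; apply: measurable_funM => //.
    exact: measurable_funB sX.1 mZ'.
  move=> w _; rewrite abseM !abse_EFin -EFinM lee_fin normrM.
  by apply: ler_wpM2r => //; rewrite [leRHS]ger0_norm.
have ZnV n : \int[P]_w (Zn n w * V w)%:E = 0.
  exact: integral_cond_expectation_orth.
have intZn n : \int[P]_w (Zn n w ^+ 2)%:E <= \int[P]_w (X w ^+ 2)%:E.
  (* Subtracting twice the mean-zero term [Zn V] reduces the claim to a pointwise inequality. *)
  have -> : \int[P]_w (X w ^+ 2)%:E =
      \int[P]_w ((X w ^+ 2)%:E - 2%:E * (Zn n w * V w)%:E).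
    rewrite integralB//; [|exact: sX.2|exact: integrableZl].
    by rewrite integralZl// ZnV mule0 sube0.
  apply: le_integral => //.
  - apply: (@le_integrable _ _ _ _ _ _ _ (cst (n%:R ^+ 2)%:E)) => //.
    + exact/measurable_EFinP/measurable_funX.
    + move=> w _; rewrite !abse_EFin lee_fin !normrX lerXn2r ?nnegrE//.
      by rewrite [leRHS]ger0_norm.
    + exact: finite_measure_integrable_cst.
  - by apply: integrableB => //; [exact: sX.2|exact: integrableZl].
  - (* [Zn^2 = Zn Z = Zn X - Zn V <= (Zn^2 + X^2) / 2 - Zn V] *)
    move=> w _; rewrite -EFinM -EFinB lee_fin /V mulrBr ZnZ.
    have := sqr_ge0 (X w - Zn n w)%R; nra.
apply: square_integrable_lty => //.
have := sX.2 => /integrable_lty -/(_ measurableT); apply: le_lt_trans.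
have sqZ w : limn (fun n => (Zn n w ^+ 2)%:E) = (Z w ^+ 2)%:E.
  apply/cvg_lim => //; apply: cvg_near_cst.
  exists (Num.truncn `|Z w|).+1 => // n /= Zwn; rewrite /Zn ifT//.
  by apply/ltW/(lt_le_trans (truncnS_gt _)); rewrite ler_nat.
under [leLHS]eq_integral do rewrite -sqZ.
have mono : \int[P]_w (Zn n w ^+ 2)%:E @[n --> \oo] -->
    \int[P]_w limn (fun n => (Zn n w ^+ 2)%:E).
  apply: cvg_monotone_convergence => //.
  - by move=> n; exact/measurable_EFinP/measurable_funX.
  - by move=> n w _; rewrite lee_fin sqr_ge0.
  - move=> w _ m n mn; rewrite lee_fin /Zn; case: ifPn => Zm.
      by rewrite ifT// (le_trans Zm)// ler_nat.
    by rewrite expr0n; exact: sqr_ge0.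
rewrite -(cvg_lim _ mono)//; apply: lime_le; last exact: nearW.
by apply/cvg_ex; eexists; exact: mono.
Qed.
End cond_expectation_square.

(** * Essential suprema of families of functions *)

Section essential_supremum.
Context {d : measure_display} {Omega : measurableType d} {R : realType}.
Variable P : probability Omega R.
Local Open Scope ereal_scope.

(* The countable union of sets from [S] of maximal probability absorbs every
   set of [S] up to a null set. *)
Lemma ess_union_seq (S : set (set Omega)) : S !=set0 -> S `<=` measurable ->
  exists2 B : nat -> set Omega, (forall n, S (B n)) &
    forall E, S E -> P (E `\` \bigcup_n B n) = 0.
Proof.
move=> [E0 SE0] mS.
pose D : set (nat -> set Omega) := [set B | forall n, S (B n)].
pose U (B : nat -> set Omega) := P (\bigcup_n B n).
have mU B : D B -> measurable (\bigcup_n B n).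
  by move=> DB; apply: bigcup_measurable => n _; apply: mS.
have [|u Du ucvg] := @ereal_sup_seq _ (U @` D).
  by apply/set0P; exists (U (cst E0)), (cst E0).
have /choice[Bk Bku] k : exists B, D B /\ U B = u k.
  by have [B DB UB] := Du k; exists B.
(* A maximizing sequence of countable unions is merged into one: the double array is flattened by
   coding pairs, with [E0] at indices that code no pair. *)
pose B n :=
  if (unpickle n : option (nat * nat)) is Some kl then Bk kl.1 kl.2 else E0.
have DB : D B.
  move=> n; rewrite /B; case: unpickle => [[k l]|]//.
  by have [/(_ l)] := Bku k.
have supB : ereal_sup (U @` D) <= U B.
  rewrite -(cvg_lim _ ucvg)//; apply: lime_le.
    by apply/cvg_ex; eexists; exact: ucvg.
  apply: nearW => k; have [Dk <-] := Bku k.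
  apply: le_measure; rewrite ?inE; [exact: mU|exact: mU|].
  move=> w [l _ Bw]; exists (pickle (k, l)) => //.
  by rewrite /B pickleK.
exists B => // E SE; have mE := mS _ SE.
have mD : measurable (E `\` \bigcup_n B n) by apply: measurableD => //; exact: mU.
(* Prepending [E] gives another competitor, so by maximality its union has no more mass than that of
   [B]. *)
have : U (fun n => if n is n'.+1 then B n' else E) <= U B.
  apply: le_trans supB; apply: ereal_sup_ubound.
  by exists (fun n => if n is n'.+1 then B n' else E) => //; case.
rewrite /U [X in P X](_ : _ = (\bigcup_n B n) `|` (E `\` \bigcup_n B n)); last first.
  apply/seteqP; split => w.
    move=> [[_ Ew|n _ Bw]]; last by left; exists n.
    by have [?|?] := pselect ((\bigcup_n B n) w); [left|right].
  by move=> [[n _ Bw]|[Ew _]]; [exists n.+1|exists 0%N].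
rewrite measureU//; [|exact: mU|by rewrite setDIK].
rewrite -[leRHS]adde0 leeD2lE; last by rewrite fin_num_measure//; exact: mU.
by move=> PD; apply/eqP; rewrite -measure_le0.
Qed.

(** An enumeration of the rationals, the levels at which functions are compared, padded by [0] at
    indices that code none. *)
Let dense_seq (n : nat) : R :=
  if (unpickle n : option rat) is Some q then ratr q else 0%R.

Let ereal_lt_dense (x y : \bar R) : x < y ->
  exists n, x <= (dense_seq n)%:E < y.
Proof.
have dense (a b : R) : (a < b)%R -> exists n, (a < dense_seq n < b)%R.
  move=> /rat_in_itvoo[q]; rewrite in_itv/= => qab.
  by exists (pickle q); rewrite /dense_seq pickleK.
case: x y => [x| |] [y| |]//=.
- rewrite lte_fin => /dense[n /andP[/ltW ? ?]]; exists n.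
  by rewrite lee_fin lte_fin; apply/andP.
- have [n /andP[/ltW xn _] _] := @dense x (x + 1)%R ltac:(lra).
  by exists n; rewrite lee_fin xn ltry.
- have [n /andP[_ ny] _] := @dense (y - 1)%R y ltac:(lra).
  by exists n; rewrite leNye lte_fin ny.
- by exists 0%N; rewrite leNye ltry.
Qed.

Variable G : set (set Omega).
Hypotheses (sG : sigma_algebra setT G) (Gm : G `<=` measurable).

(** A countable subfamily suffices: at each rational level [r], countably many superlevel sets
    [{f > r}] absorb all the others up to null sets. Pooling these over all levels gives [F], whose
    pointwise supremum ([esups] from index [0]) is [G]-measurable and is the essential supremum. *)
Lemma ess_sup_familyP (A : set (Omega -> \bar R)) : A !=set0 ->
  (forall f, A f ->
    measurable_fun setT (f : g_sigma_algebraType G -> \bar R)) ->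
  is_ess_sup_family P G A (ess_sup_family P G A).
Proof.
move=> [f0 Af0] mA; rewrite /ess_sup_family; case: xgetP => [Z -> //|noZ]; exfalso.
have mA' f : A f -> measurable_fun setT f.
  by move=> Af; apply: (@measurable_fun_g_sigma _ _ G sG Gm); exact: mA.
have mlt f q : A f -> measurable [set w | q%:E < f w].
  move=> Af; rewrite -[X in measurable X]setTI.
  exact: emeasurable_fun_o_infty measurableT (mA' f Af) _.
have /choice[f fP] k : exists f : nat -> Omega -> \bar R, (forall n, A (f n)) /\
    forall g, A g -> {ae P, forall w, (dense_seq k)%:E < g w ->
      exists n, (dense_seq k)%:E < f n w}.
  pose L (g : Omega -> \bar R) := [set w | (dense_seq k)%:E < g w].
  have [||B BA BP] := @ess_union_seq (L @` A).
  - by exists (L f0), f0.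
  - by move=> _ [g Ag <-]; exact: mlt.
  have /choice[f fB] n : exists g, A g /\ L g = B n.
    by have [g Ag gB] := BA n; exists g.
  exists f; split => [n|g Ag]; first by have [] := fB n.
  exists (L g `\` \bigcup_n B n); split.
  - apply: measurableD; first exact: mlt.
    apply: bigcup_measurable => n _; have [Afn <-] := fB n; exact: mlt.
  - by apply: BP; exists g.
  - move=> w /= /not_implyP[gw nf]; split => // -[n _].
    have [_ <-] := fB n => fw; apply: nf; by exists n.
pose F n :=
  if (unpickle n : option (nat * nat)) is Some kl then f kl.1 kl.2 else f0.
have AF n : A (F n).
  by rewrite /F; case: unpickle => [[k l]|]//; exact: (fP k).1.
have leF n w : F n w <= esups (F ^~ w) 0%N.
  by apply: ereal_sup_ubound; exists n.
apply: (noZ (fun w => esups (F ^~ w) 0%N)); split.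
- by apply: measurable_fun_esups => n; exact: mA.
- move=> g Ag; have := ae_foralln (fun k => (fP k).2 g Ag).
  (* If [g w] exceeded the supremum, a rational level would separate them, and some member of [F]
     would exceed that level at [w]. *)
  apply: filterS => w gF; rewrite leNgt; apply/negP => /ereal_lt_dense[k /andP[Fk kg]].
  have [l kl] := gF k kg; move: Fk; rewrite leNgt => /negP; apply.
  by apply: (lt_le_trans kl); have := leF (pickle (k, l)) w; rewrite /F pickleK.
- move=> Z' mZ' AZ'; have := ae_foralln (fun n => AZ' _ (AF n)).
  by apply: filterS => w FZ'; apply: ge_ereal_sup => _ [n _ <-]; exact: FZ'.
Qed.
End essential_supremum.

(** * Stopped sigma-algebras and processes sampled at stopping times *)

Section stopping_times.
Context {d : measure_display} {Omega : measurableType d} {R : realType}.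
Variables (T : R) (F : R -> set (set Omega)).
Hypotheses (T0 : 0 < T) (hF : is_filtration T F).

Lemma sigma_algebra_setI (G : set (set Omega)) A B :
  sigma_algebra setT G -> G A -> G B -> G (A `&` B).
Proof.
by move=> sG GA GB; rewrite -(measurable_g_sigmaE sG); apply: measurableI;
  rewrite measurable_g_sigmaE.
Qed.

Lemma stopping_time_cst (c : R) : 0 <= c <= T ->
  stopping_time T F (cst c : Omega -> R).
Proof.
move=> cT; split=> // t tT; have [F0 FC _] := filtration_sigma hF tT.
have [ct|ct] := boolP (c <= t).
  rewrite (_ : [set _ | _] = setT `\` set0); first exact: FC.
  by rewrite setD0; apply/seteqP.
rewrite (_ : [set _ | _] = set0)//; apply/seteqP; split => // w /=.
Qed.

Lemma sigma_algebra_stopped tau : stopping_time T F tau ->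
  sigma_algebra setT (stopped_sigma T F tau).
Proof.
move=> [_ Ftau]; split=> [t tT|A FA t tT|A FA t tT].
- by rewrite set0I; have [] := filtration_sigma hF tT.
- have sF := filtration_sigma hF tT; have [_ FC _] := sF.
  rewrite (_ : _ `&` _ = (setT `\` (A `&` [set w | tau w <= t])) `&`
      [set w | tau w <= t]).
    by apply: sigma_algebra_setI => //; [apply: FC; exact: FA|exact: Ftau].
  rewrite !setTD setCI setIUl setICl setU0//.
- have [_ _ FU] := filtration_sigma hF tT.
  by rewrite setI_bigcupl; apply: FU => n; exact: FA.
Qed.

Lemma stopped_sigma_measurable tau : stopping_time T F tau ->
  stopped_sigma T F tau `<=` measurable.
Proof.
move=> [tauT _] A FA.
have TT : 0 <= T <= T by rewrite lexx ltW.
apply: (filtration_sub hF TT); rewrite -(setIT A) (_ : setT = [set w | tau w <= T]).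
  exact: FA.
by apply/seteqP; split => // w _ /=; have /andP[] := tauT w.
Qed.

Lemma stopped_sigma_homo sigma tau : stopping_time T F sigma ->
  stopping_time T F tau -> (forall w, sigma w <= tau w) ->
  stopped_sigma T F sigma `<=` stopped_sigma T F tau.
Proof.
move=> hsigma [_ Ftau] st A FA t tT.
rewrite (_ : _ `&` _ = (A `&` [set w | sigma w <= t]) `&` [set w | tau w <= t]).
  apply: (sigma_algebra_setI (filtration_sigma hF tT)); first exact: FA.
  exact: Ftau.
rewrite -setIA; congr (_ `&` _); apply/seteqP; split => [w taut|w []//].
by split => //; exact: le_trans (st w) taut.
Qed.

(** On [{tau <= t}] the sampled value is [Y] at [min(tau, t)]. That variable is [F t]-measurable,
    being the composition of [Y], jointly measurable on [[0, t] x Omega], with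
    [w |-> (min(tau w, t), w)]. *)
Lemma measurable_at_time Y tau : progressively_measurable T F Y ->
  stopping_time T F tau ->
  measurable_fun setT
    (at_time Y tau : g_sigma_algebraType (stopped_sigma T F tau) -> R).
Proof.
move=> mY stau; have [tauT Ftau] := stau.
move=> _ B mB; rewrite setTI (measurable_g_sigmaE (sigma_algebra_stopped stau)).
move=> t tT; have sF := filtration_sigma hF tT.
pose mint w : R := Num.min (tau w) t.
have mmint : measurable_fun setT
    (mint : g_sigma_algebraType (F t) -> measurableTypeR R).
  apply: (measurability _ (RGenOInfty.measurableE R)) => _ [_ [x ->] <-].
  rewrite measurable_g_sigmaE// setTI; have [Ft0 FtC _] := sF.
  have -> : mint @^-1` `]x, +oo[ = [set w | x < tau w /\ x < t].
    apply/seteqP; split => w /=; rewrite in_itv/= andbT /mint lt_min.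
      by move=> /andP.
    by move=> /andP.
  (* The event is empty for [t <= x], everything for [x < 0], and otherwise the complement of
     [{tau <= x}], which lies in [F x] and hence in [F t]. *)
  have [tx|xt] := leP t x.
    by rewrite (_ : [set _ | _] = set0)//; apply/seteqP; split => w //= [].
  have [x0|x0] := ltP x 0.
    rewrite (_ : [set _ | _] = setT `\` set0); first exact: FtC.
    rewrite setD0; apply/seteqP; split => // w _ /=; split => //.
    by apply: lt_le_trans x0 _; have /andP[] := tauT w.
  have /andP[_ tT'] := tT.
  rewrite (_ : [set _ | _] = setT `\` [set w | tau w <= x]).
    apply: FtC; apply: (filtration_homo hF x0 (ltW xt) tT').
    by apply: Ftau; rewrite x0 (le_trans (ltW xt)).
  rewrite setTD; apply/seteqP; split => w /=.
    by move=> [xw _]; apply/negP; rewrite -ltNge.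
  by move=> /negP; rewrite -ltNge.
have mYt : measurable_fun setT
    (fun w : g_sigma_algebraType (F t) => Y (mint w) w).
  have mpair : measurable_fun setT (fun w : g_sigma_algebraType (F t) =>
    (mint w : measurableTypeR R, w)) by apply: measurable_fun_pair.
  apply: (measurable_comp _ _ (mY t tT) mpair).
    apply: measurableX => //; exact: measurable_itv.
  move=> _ [w _ <-]; split => //=; rewrite in_itv/= le_min ge_min lexx orbT andbT.
  by have /andP[-> _] := tauT w; have /andP[-> _] := tT.
rewrite (_ : _ `&` _ = (fun w => Y (mint w) w) @^-1` B `&` [set w | tau w <= t]).
  apply: sigma_algebra_setI => //; last exact: Ftau.
  by rewrite -(measurable_g_sigmaE sF) -[X in measurable X]setTI; exact: mYt.
apply/seteqP; split=> w [] /= + taut; rewrite /mint /at_time (min_idPl taut)//.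
Qed.
End stopping_times.

(** * A pathwise inequality for discrete increments *)

Section discrete_decomposition.
Context {R : realType}.
Implicit Types (p y a : nat -> R).

(** The square splits into the part on and above the diagonal and the part strictly below it;
    transposed, the latter is at most the former because the diagonal terms are nonnegative. *)
Lemma sqr_sum_le n a : (forall i, 0 <= a i) ->
  (\sum_(i < n) a i) ^+ 2 <=
  2 * \sum_(i < n) \sum_(j < n | (i <= j)%N) a i * a j.
Proof.
move=> a0; rewrite expr2 mulr_suml [2]mulr2n mulrDl mul1r.
have -> : \sum_(i < n) a i * \sum_(j < n) a j = \sum_(i < n)
    (\sum_(j < n | (i <= j)%N) a i * a j + \sum_(j < n | (j < i)%N) a i * a j).
  apply: eq_bigr => i _; rewrite mulr_sumr (bigID (fun j : 'I_n => (i <= j)%N))/=.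
  by congr (_ + _); apply: eq_bigl => j; rewrite ltnNge.
rewrite big_split/= lerD2l [leRHS](exchange_big_dep xpredT)//=.
apply: ler_sum => i _; rewrite [leRHS](bigID (fun j : 'I_n => (j < i)%N))/=.
rewrite [leLHS](eq_bigl (fun j : 'I_n => (j <= i)%N && (j < i)%N)); last first.
  by move=> j; rewrite andb_idl// => /ltnW.
rewrite (eq_bigr (fun j : 'I_n => a j * a i)) => [|j _]; last exact: mulrC.
by rewrite lerDl; apply: sumr_ge0 => j _; exact: mulr_ge0.
Qed.

Lemma telescope_ord n y (i : 'I_n) :
  \sum_(j < n | (i <= j)%N) (y j.+1 - y j) = y n - y i.
Proof.
by rewrite -(telescope_sumr _ (ltnW (ltn_ord i))) big_geq_mkord.
Qed.

(* The last sum has mean zero when [p j] is the conditional expectation of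
   [y j.+1 - y j]. *)
Lemma discrete_variation_le n p y (S : R) :
  (forall i, (i <= n)%N -> `|y i| <= S) ->
  (\sum_(i < n) `|p i|) ^+ 2 <=
    18 * (\sum_(i < n) Num.max (p i) 0) ^+ 2 + 64 * S ^+ 2 +
    4 * \sum_(i < n) \sum_(j < n | (i <= j)%N)
          Num.max (- p i) 0 * (y j.+1 - y j - p j).
Proof.
move=> yS.
pose q i := Num.max (p i) 0; pose m i := Num.max (- p i) 0.
have m0 i : 0 <= m i by rewrite le_max lexx orbT.
have q0 i : 0 <= q i by rewrite le_max lexx orbT.
have pE i : p i = q i - m i.
  by rewrite /q /m; case: (leP (p i) 0); case: (leP (- p i) 0); lra.
have normE i : `|p i| = q i + m i.
  rewrite /q /m; case: (leP (p i) 0) => pi.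
    by rewrite ler0_norm// (max_idPl _) ?oppr_ge0// add0r.
  by rewrite gtr0_norm// (max_idPr _) ?addr0// oppr_le0 ltW.
rewrite (eq_bigr (fun i : 'I_n => q i + m i)) => [|i _]; last exact: normE.
rewrite big_split/=.
set Q := \sum_(i < n) q i; set N := \sum_(i < n) m i.
set D := \sum_(i < n) _.
have N0 : 0 <= N by exact: sumr_ge0.
have Q0 : 0 <= Q by exact: sumr_ge0.
have S0 : 0 <= S by exact: le_trans (yS 0%N isT).
have NN : N ^+ 2 <= 2 * (N * (Q + 2 * S)) + 2 * D.
  apply: (le_trans (sqr_sum_le n m0)); rewrite -mulrDr ler_pM2l//.
  rewrite /N mulr_suml -big_split/=; apply: ler_sum => i _.
  (* For fixed [i], write [m j = q j - (y j.+1 - y j) + (y j.+1 - y j - p j)]: the last bracket is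
     the one in [D], and the increments telescope to at most [2 * S] in absolute value. *)
  rewrite -!mulr_sumr -mulrDr ler_wpM2l// -lerBlDr -sumrB.
  rewrite (eq_bigr (fun j : 'I_n => q j - (y j.+1 - y j))); last first.
    by move=> j _; rewrite (pE j); ring.
  rewrite sumrB telescope_ord.
  have Qi : \sum_(j < n | (i <= j)%N) q j <= Q.
    by rewrite /Q [leRHS](bigID (fun j : 'I_n => (i <= j)%N))/= lerDl sumr_ge0.
  have := yS n (leqnn n); have := yS i (ltnW (ltn_ord i)).
  rewrite !ler_norml => /andP[? ?] /andP[? ?]; lra.
(* Twice [NN] accounts for [4 * D]. What remains is nonnegativity of
   [N^2 - 6 N Q - 8 N S + 17 Q^2 + 64 S^2], which equals [(N - 3 Q - 4 S)^2 + 8 (Q - 3/2 S)^2 + 30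
   S^2]. *)
have := sqr_ge0 (N - 2 * (Q + 2 * S)); have := sqr_ge0 (N - Q).
have := sqr_ge0 (Q - 2 * S); nra.
Qed.
End discrete_decomposition.

(** * Measurability and monotonicity of integrals *)

Section integral_comparison.
Context {d : measure_display} {Omega : measurableType d} {R : realType}.
Local Open Scope ereal_scope.

Lemma measurable_fun_g_sigmaS (G H : set (set Omega)) (f : Omega -> R) :
  sigma_algebra setT G -> sigma_algebra setT H -> G `<=` H ->
  measurable_fun setT (f : g_sigma_algebraType G -> R) ->
  measurable_fun setT (f : g_sigma_algebraType H -> R).
Proof.
move=> sG sH GH mf _ B mB; rewrite measurable_g_sigmaE//; apply: GH.
by rewrite -(measurable_g_sigmaE sG); exact: mf.
Qed.

(** The fallback of [xget] is a constant, so this also covers competitors [P'] for which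
    integrability is not at hand. *)
Lemma measurable_cond_expectation (P : probability Omega R) G X :
  measurable_fun setT (cond_expectation P G X : g_sigma_algebraType G -> R).
Proof. by rewrite /cond_expectation; case: xgetP => [Z _ []|_]. Qed.

Lemma sup_sq_ge (T : R) (Y : R -> Omega -> R) t w : (0 <= t <= T)%R ->
  ((Y t w) ^+ 2)%:E <= sup_sq T Y w.
Proof.
by move=> tT; apply: ereal_sup_ubound; exists t => //; rewrite real_normK ?num_real.
Qed.

(* [ge0_le_integral] asks for measurability, which is not available for
   [sup_sq], a supremum over an uncountable set of times. *)
Lemma ge0_integral_mono (P : probability Omega R) (f g : Omega -> \bar R) :
  (forall w, 0 <= f w) -> (forall w, f w <= g w) ->
  \int[P]_w f w <= \int[P]_w g w.
Proof.
move=> f0 fg; rewrite !ge0_integralTE// => [|w]; last exact: le_trans (fg w).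
by apply: le_ereal_sup => _ [h hf <-]; exists h => // w; exact: le_trans (fg w).
Qed.

Lemma measurable_bigmax n (f : nat -> Omega -> R) :
  (forall i, (i < n)%N -> measurable_fun setT (f i)) ->
  measurable_fun setT (fun w => \big[Num.max/0%R]_(i < n) f i w).
Proof.
elim: n f => [|n IH] f mf; last first.
  under eq_fun do rewrite big_ord_recl.
  apply: measurable_maxr; first exact: mf.
  by apply: (IH (fun i => f i.+1)) => i i_n; exact: mf.
by under eq_fun do rewrite big_ord0; exact: measurable_cst.
Qed.

End integral_comparison.

(** * The two variations along a fixed partition *)

Section conditional_variation.
Context {d : measure_display} {Omega : measurableType d} {R : realType}.
Variables (T : R) (F : R -> set (set Omega)) (calP : set (probability Omega R)).
Hypotheses (T0 : (0 < T)%R) (hF : is_filtration T F).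
Variables (Y : R -> Omega -> R) (n : nat) (tau : nat -> Omega -> R).
Hypotheses (mY : progressively_measurable T F Y)
  (htau : stopping_partition T F n tau).
Variables (P : probability Omega R).
Hypothesis PP : calP P.
Hypothesis supY : (\int[P]_w sup_sq T Y w < +oo)%E.
Local Open Scope ereal_scope.

Let G i := stopped_sigma T F (tau i).
Let y i w : R := at_time Y (tau i) w.
Let Z i := cond_expectation P (G i) (y i.+1).
Let p i w := (Z i w - y i w)%R.

Let stau i : (i <= n)%N -> stopping_time T F (tau i).
Proof. by case: htau => + _ _ _; exact. Qed.

Let sG i : (i <= n)%N -> sigma_algebra setT (G i).
Proof. by move=> /stau; exact: sigma_algebra_stopped. Qed.

Let Gm i : (i <= n)%N -> G i `<=` measurable.
Proof. by move=> /stau; exact: stopped_sigma_measurable. Qed.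

Let GS i j : (i <= j)%N -> (j <= n)%N -> G i `<=` G j.
Proof.
move=> ij jn; apply: (stopped_sigma_homo hF (stau (leq_trans ij jn)) (stau jn)) => w.
elim: j ij jn => [|j IH]; first by rewrite leqn0 => /eqP ->.
rewrite leq_eqVlt => /predU1P[<- _ //|]; rewrite ltnS => ij jn.
apply: (le_trans (IH ij (ltnW jn))); case: htau => _ _ _; exact.
Qed.

Let mG i : (i <= n)%N -> measurable_fun setT (y i : g_sigma_algebraType (G i) -> R).
Proof. by move=> /stau; exact: measurable_at_time. Qed.

Let my i : (i <= n)%N -> measurable_fun setT (y i).
Proof.
by move=> i_n; apply: (measurable_fun_g_sigma (sG i_n) (Gm i_n)); exact: mG.
Qed.

Let y_sup i w : (i <= n)%N -> ((y i w) ^+ 2)%:E <= sup_sq T Y w.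
Proof. by move=> /stau[tauT _]; exact: sup_sq_ge. Qed.

Let sqy i : (i <= n)%N -> square_integrable P (y i).
Proof.
move=> i_n; apply: square_integrable_lty; first exact: my.
apply: le_lt_trans supY; apply: ge0_integral_mono => w.
  by rewrite lee_fin sqr_ge0.
exact: y_sup.
Qed.

Let sqZ i : (i < n)%N -> square_integrable P (Z i).
Proof.
move=> i_n; apply: square_integrable_cond_expectation; last exact: sqy.
  exact/sG/ltnW.
exact/Gm/ltnW.
Qed.

Let sqp i : (i < n)%N -> square_integrable P (p i).
Proof.
move=> i_n; apply: square_integrableD; first exact: sqZ.
by apply: square_integrableN; exact/sqy/ltnW.
Qed.

Let mp i : (i < n)%N -> measurable_fun setT (p i : g_sigma_algebraType (G i) -> R).
Proof.
move=> i_n; apply: measurable_funB; first exact: measurable_cond_expectation.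
exact: mG (ltnW i_n).
Qed.

Let q i w := Num.max (p i w) 0%R.
Let m i w := Num.max (- p i w)%R 0%R.

Let sqq i : (i < n)%N -> square_integrable P (q i).
Proof.
move=> i_n; apply: (square_integrable_le _ _ (sqp i_n)).
  by apply: measurable_maxr => //; exact: (sqp i_n).1.
by move=> w; rewrite /q; case: (leP (p i w) 0%R) => ?; rewrite ?normr0 ?normr_ge0.
Qed.

Let mm i : (i < n)%N -> measurable_fun setT (m i : g_sigma_algebraType (G i) -> R).
Proof.
by move=> i_n; apply: measurable_maxr => //; apply: measurable_funN; exact: mp.
Qed.

Let sqm i : (i < n)%N -> square_integrable P (m i).
Proof.
move=> i_n; apply: (square_integrable_le _ _ (sqp i_n)).
  by apply: (measurable_fun_g_sigma (sG (ltnW i_n)) (Gm (ltnW i_n))); exact: mm.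
by move=> w; rewrite /m; case: (leP (- p i w)%R 0%R) => ?;
  rewrite ?normr0 ?normr_ge0 ?normrN.
Qed.

(** Padding by [0] below the diagonal lets the double sum run over the full square, where integrals
    are exchanged with sums. *)
Let term i j w :=
  (if (i <= j)%N then m i w * (y j.+1 w - y j w - p j w) else 0)%R.

Let termE i j : (i <= j)%N ->
  term i j = (fun w => m i w * (y j.+1 w - Z j w))%R.
Proof.
by move=> ij; apply/funext => w; rewrite /term ij /p; congr (_ * _)%R; ring.
Qed.

Let iterm i j : (j < n)%N -> P.-integrable setT (fun w => (term i j w)%:E).
Proof.
move=> jn; have [ij|/negbTE ij] := boolP (i <= j)%N; last first.
  by under eq_fun do rewrite /term ij; exact: integrable0.
rewrite termE//; apply: square_integrableM; first exact: sqm (leq_ltn_trans ij jn).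
by apply: square_integrableD; [exact: sqy|apply: square_integrableN; exact: sqZ].
Qed.

(** For [i <= j] the weight [m i] is [G j]-measurable, while [y j.+1 - Z j] is orthogonal to such
    weights. *)
Let term0 i j : (j < n)%N -> \int[P]_w (term i j w)%:E = 0.
Proof.
move=> jn; have [ij|/negbTE ij] := boolP (i <= j)%N; last first.
  by rewrite integral0_eq// => w _; rewrite /term ij.
have jn' := ltnW jn; have i_n := leq_ltn_trans ij jn.
have := @iterm i j jn; rewrite termE// => it.
apply: (integral_cond_expectation_orth (sG jn') (Gm jn')) => //.
  by apply: square_integrable1; exact: sqy.
by apply: measurable_fun_g_sigmaS (mm i_n); [exact/sG/ltnW|exact: sG|exact: GS].
Qed.

Let D w := (\sum_(i < n) \sum_(j < n) term i j w)%R.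

Let DE w : (D w)%:E = \sum_(i < n) \sum_(j < n) (term i j w)%:E.
Proof. by rewrite -sumEFin; apply: eq_bigr => i _; rewrite sumEFin. Qed.

Let iD : P.-integrable setT (fun w => (D w)%:E).
Proof.
under eq_fun do rewrite DE.
by apply: integrable_sum => // i _; apply: integrable_sum => // j _; exact: iterm.
Qed.

Let D0 : \int[P]_w (D w)%:E = 0.
Proof.
under eq_integral do rewrite DE.
rewrite integral_sum// => [|i]; last first.
  by apply: integrable_sum => // j _; exact: iterm.
rewrite big1// => i _; rewrite integral_sum// => [|j]; last exact: iterm.
by rewrite big1// => j _; exact: term0.
Qed.

(** A measurable substitute for the square root of [sup_sq]. It ranges over [n.+1] indices because
    the terminal value [y n] appears after telescoping. *)
Let S w := \big[Num.max/0%R]_(i < n.+1) `|y i w|%R.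

Let S_ge i w : (i <= n)%N -> (`|y i w| <= S w)%R.
Proof.
move=> i_n; have iS : (i < n.+1)%N by [].
exact: (le_bigmax 0%R (fun k : 'I_n.+1 => `|y k w|%R) (Ordinal iS)).
Qed.

Let S_sup w : (S w ^+ 2)%:E <= sup_sq T Y w.
Proof.
rewrite /S; apply: (big_ind (fun x : R => (x ^+ 2)%:E <= sup_sq T Y w)).
- by rewrite expr0n; apply: le_trans (y_sup w (leq0n n)); rewrite lee_fin sqr_ge0.
- by move=> a b; case: (leP a b).
- by move=> i _; rewrite real_normK ?num_real//; exact: y_sup (ltn_ord i).
Qed.

Let sqS : square_integrable P S.
Proof.
apply: square_integrable_lty.
  apply: (measurable_bigmax (f := fun i w => `|y i w|%R)) => i i_n.
  apply: measurableT_comp => //.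
  exact: my.
apply: le_lt_trans supY; apply: ge0_integral_mono => w //.
by rewrite lee_fin sqr_ge0.
Qed.

Let Q w : R := (\sum_(i < n) q i w)%R.

Let sqQ : square_integrable P Q.
Proof. by apply: square_integrable_sum => i; exact: sqq. Qed.

Let variation_PE w : variation_P T F P Y n tau w = (\sum_(i < n) `|p i w|)%:E.
Proof.
by rewrite /variation_P -sumEFin; apply: eq_bigr => i _; rewrite -EFinB abse_EFin.
Qed.

Lemma variation_P_le :
  \int[P]_w (variation_P T F P Y n tau w) ^+ 2 <=
  18%:E * \int[P]_w (Q w ^+ 2)%:E + 64%:E * \int[P]_w sup_sq T Y w.
Proof.
(* The pathwise bound as a single majorant. [D] has no sign, so its integral is split off by
   integrability. *)
pose B w : \bar R :=
  18%:E * (Q w ^+ 2)%:E + 64%:E * (S w ^+ 2)%:E + 4%:E * (D w)%:E.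
have iQ : P.-integrable setT (fun w => 18%:E * (Q w ^+ 2)%:E).
  by apply: integrableZl => //; exact: sqQ.2.
have iS : P.-integrable setT (fun w => 64%:E * (S w ^+ 2)%:E).
  by apply: integrableZl => //; exact: sqS.2.
have iQS := integrableD measurableT iQ iS.
have iD4 : P.-integrable setT (fun w => 4%:E * (D w)%:E) by exact: integrableZl.
have iB : P.-integrable setT B by exact: integrableD.
apply: (@le_trans _ _ (\int[P]_w B w)).
  under eq_integral do rewrite variation_PE -EFin_expe.
  apply: le_integral => //.
    apply: (square_integrable_sum (f := fun (i : 'I_n) w => `|p i w|%R) _).2 => i.
    apply: (square_integrable_le _ _ (sqp (ltn_ord i))) => [|w].
      by apply: measurableT_comp => //; exact: (sqp (ltn_ord i)).1.
    by rewrite normr_id.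
  move=> w _; rewrite /B -!EFinM -!EFinD lee_fin.
  have -> : D w = (\sum_(i < n) \sum_(j < n | (i <= j)%N)
      m i w * (y j.+1 w - y j w - p j w))%R.
    by apply: eq_bigr => i _; rewrite [RHS]big_mkcond.
  apply: (@discrete_variation_le _ n (p ^~ w) (y ^~ w)) => i.
  exact: S_ge.
rewrite integralD// integralD// !integralZl//; [|exact: sqS.2|exact: sqQ.2].
rewrite D0 mule0 adde0 leeD2l// lee_pmul2l//.
apply: ge0_integral_mono => w //; by rewrite lee_fin sqr_ge0.
Qed.

Let E i := cond_G_expectation T F calP P (tau i) (y i.+1).

(** [P] agrees with itself on [G i], so the family is nonempty and contains [Z i]. *)
Let EP i : (i < n)%N ->
  measurable_fun setT (E i) /\ {ae P, forall w, (Z i w)%:E <= E i w}.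
Proof.
move=> i_n; have sGi := sG (ltnW i_n); have Gmi := Gm (ltnW i_n).
have ZA : [set EFin \o cond_expectation P' (G i) (y i.+1)
    | P' in agreeing T F calP (tau i) P] (EFin \o Z i) by exists P.
have A0 : [set EFin \o cond_expectation P' (G i) (y i.+1)
    | P' in agreeing T F calP (tau i) P] !=set0 by exists (EFin \o Z i).
have [|mE EZ _] := @ess_sup_familyP _ _ _ P _ sGi Gmi _ A0.
  move=> _ [P' _ <-]; apply/measurable_EFinP; exact: measurable_cond_expectation.
split; last exact: EZ ZA.
exact: (measurable_fun_g_sigma sGi Gmi mE).
Qed.

Lemma integral_sqr_positive_part_le :
  \int[P]_w (Q w ^+ 2)%:E <= \int[P]_w (variation_G T F calP P Y n tau w) ^+ 2.
Proof.
have mV : measurable_fun setT (variation_G T F calP P Y n tau).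
  apply: emeasurable_sum => i.
  apply: measurableT_comp => //; apply: emeasurable_funB.
    exact: (EP (ltn_ord i)).1.
  by apply/measurable_EFinP; exact: my (ltnW (ltn_ord i)).
apply: ae_ge0_le_integral => //.
- by move=> w _; rewrite lee_fin sqr_ge0.
- exact: measurable_int sqQ.2.
- by move=> w _; exact: sqre_ge0.
- exact: emeasurable_funM.
(* One null set serves all indices; for [k >= n] the claim is vacuous. *)
have : {ae P, forall w, forall k, (k < n)%N -> (Z k w)%:E <= E k w}.
  apply: ae_foralln => k; have [kn|nk] := boolP (k < n)%N.
    by apply: filterS (EP kn).2.
  by apply: aeW.
apply: filterS => w ZE _.
have QV : (Q w)%:E <= variation_G T F calP P Y n tau w.
  rewrite /Q -sumEFin; apply: lee_sum => i _.
  have := ZE i (ltn_ord i); rewrite -/(y i w) -/(E i) /q /p.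
  (* Where [E i w] is infinite, the [G]-increment is [+oo] in absolute value and the bound is
     immediate. *)
  case: (E i w) => [e| |].
  - rewrite lee_fin -EFinB abse_EFin lee_fin => Ze.
    by rewrite ge_max normr_ge0 andbT (le_trans _ (ler_norm _))// lerB.
  - by move=> _; exact: leey.
  - by move=> _; exact: leey.
rewrite EFin_expe lee_sqr ?sume_ge0// lee_fin.
by apply: sumr_ge0 => i _; rewrite le_max lexx orbT.
Qed.

Lemma variation_P_le_variation_G :
  \int[P]_w (variation_P T F P Y n tau w) ^+ 2 <=
  18%:E * \int[P]_w (variation_G T F calP P Y n tau w) ^+ 2 +
  64%:E * \int[P]_w sup_sq T Y w.
Proof.
apply: (le_trans variation_P_le); apply: leeD2r.
by rewrite lee_pmul2l//; exact: integral_sqr_positive_part_le.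
Qed.

End conditional_variation.

(** * Comparison of the norms *)

Theorem theorem4p9 (R : realType) :
  exists C : R, 0 < C /\
    forall (T : R) (d : measure_display) (Omega : measurableType d)
      (F : R -> set (set Omega)) (calP : set (probability Omega R)),
      0 < T ->
      is_filtration T F ->
      right_continuous_filtration T F ->
      standing_assumptions T F calP ->
      forall Y : R -> Omega -> R, Dspace T F Y ->
        (norm_calP T F calP Y <= C%:E * norm_G T F calP Y)%E.
Proof.
(* When [a] is finite, the squared norm under [P] is at most [a + (18 V + 64 a) = 65 a + 18 V]; [9]
   is the least integer whose square is at least [65]. *)
exists 9; split => // T d Omega F calP T0 hF _ _ Y [mY _].
apply: ge_ereal_sup => _ [P PP <-]; rewrite /norm_P /norm_G.
set a := (\int[P]_w sup_sq T Y w)%E.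
set c := G_expectation calP (sup_sq T Y); set b := ereal_sup _.
set V := ereal_sup _.
have ac : (a <= c)%E by apply: ereal_sup_ubound; exists P.
have a0 : (0 <= a)%E.
  apply: integral_ge0 => w _; apply: le_trans (sup_sq_ge (t := 0) _ _ _).
    by rewrite lee_fin sqr_ge0.
  by rewrite lexx ltW.
have c0 : (0 <= c)%E := le_trans a0 ac.
have VV n tau : stopping_partition T F n tau ->
    (\int[P]_w (variation_G T F calP P Y n tau w) ^+ 2 <= V)%E.
  move=> ntau; apply: (@le_trans _ _
    (ereal_sup [set \int[Q]_w (variation_G T F calP Q Y n tau w) ^+ 2
               | Q in calP])%E).
    by apply: ereal_sup_ubound; exists P.
  by apply: ereal_sup_ubound; exists n, tau.
(* The supremum of an empty set would be [-oo]; the partition [0, T] rules this out. *)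
have V0 : (0 <= V)%E.
  pose tau (i : nat) : Omega -> R := cst (if i is 0%N then 0 else T).
  apply: (le_trans _ (VV 1%N tau _)).
    by apply: integral_ge0 => w _; exact: sqre_ge0.
  split => //; last by move=> [|i] w //=; rewrite ltW.
  by move=> [|i] _; apply: stopping_time_cst => //; rewrite lexx ltW.
have -> : (9%:E : \bar R) = sqrte 81%:E.
  rewrite /= -[81]/(9 * 9)%N%:R; congr EFin.
  by rewrite natrM -expr2 sqrtr_sqr ger0_norm.
rewrite -sqrteM// lee_sqrt ?mule_ge0 ?adde_ge0//.
(* If [a] is infinite, so is [c], and [V >= 0] keeps the right-hand side at [+oo]. *)
have [afin|] := ltP a +oo%E; last first.
  rewrite leye_eq => /eqP aoo; rewrite [leRHS](_ : _ = +oo%E) ?leey//.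
  move: ac; rewrite aoo leye_eq => /eqP ->.
  by rewrite addye ?gt0_muley// gt_eqF// (lt_le_trans _ V0).
have b_le : (b <= 18%:E * V + 64%:E * a)%E.
  apply: ge_ereal_sup => _ [n [tau [ntau ->]]].
  apply: (le_trans (variation_P_le_variation_G T0 hF mY ntau PP afin)).
  by apply: leeD2r; rewrite lee_pmul2l//; exact: VV.
apply: (le_trans (leeD2l a b_le)); move: a0 c0 V0 ac.
move: a c V {afin b_le VV} => a c V a0 c0 V0 ac.
rewrite ge0_muleDr// addeCA addeC; apply: leeD.
  rewrite -[X in (X + _)%E]mul1e -ge0_muleDl//; apply: lee_pmul => //;
    by rewrite -EFinD lee_fin; lra.
by apply: lee_wpmul2r => //; rewrite lee_fin; lra.
Qed.
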